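(* There is an absolute constant $C$ such that for every integer $n\ge 1$, every stable roommates instance with $n$ roommates has at most $3.55^n + C$ stable matchings.
   Context: A stable roommates instance with $n$ roommates is a complete graph on $n$ vertices in which each vertex has a strict linear order of preferences on the other $n-1$ vertices. Given a perfect matching, a pair of distinct vertices $u,v$ not matched to each other is unstable if $u$ and $v$ both prefer each other to their currently matched partners. A stable matching is a perfect matching with no unstable pair. *)

(* Defs.v *)
From mathcomp Require Import all_boot all_order all_algebra.
From mathcomp Require Import reals.

Set Implicit Arguments.
Unset Strict Implicit.
Unset Printing Implicit Defensive.

(* [prefers v x y] reads "v strictly prefers x to y".  It is a strict linear
   order on V \ {v}; its values when x = v or y = v are irrelevant. *)
Record roommates_instance (V : finType) := RoommatesInstance {
  prefers : V -> rel V;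
  prefers_irr : forall v, {in predC1 v, irreflexive (prefers v)};
  prefers_trans : forall v, {in predC1 v & &, transitive (prefers v)};
  prefers_total : forall v,
    {in predC1 v &, forall x y, x != y -> prefers v x y || prefers v y x}
}.

(* A set of edges of the complete graph on V, an edge being a 2-element set of
   vertices, that covers every vertex exactly once. *)
Definition perfect_matching (V : finType) (M : {set {set V}}) : bool :=
  partition M [set: V] && [forall e in M, #|e| == 2].

(* u' and v' range over the partners of u and v, which exist and are unique
   when M is a perfect matching. *)
Definition unstable_pair (V : finType) (I : roommates_instance V)
    (M : {set {set V}}) (u v : V) : bool :=
  [&& u != v, [set u; v] \notin M &
    [exists u', exists v',
      [&& [set u; u'] \in M, [set v; v'] \in M,
          prefers I u v u' & prefers I v u v']]].

Definition stable_matching (V : finType) (I : roommates_instance V)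
    (M : {set {set V}}) : bool :=
  perfect_matching M && [forall u, forall v, ~~ unstable_pair I M u v].

(* Main.v *)
Require Import Defs.
From mathcomp Require Import all_boot all_order all_fingroup all_algebra.
From mathcomp Require Import ring lra zify.
From mathcomp Require Import reals sequences exp.

(** Send a stable matching to its partner function, and write F for the set of
    these functions; they are determined by their values, so it suffices to
    bound #|F|.  The idea is to reveal the partners of the vertices one at a
    time, in a uniformly random order, and to bound the number of values still
    possible for each of them.

    For a fixed order, let D_v(f) be the number of values at v of those members
    of F that agree with f on the vertices before v.  Choosing each value
    uniformly among the possible ones produces f with probability
    prod_v 1 / D_v(f), so these products sum to at most 1 over F
    ([sum_inv_options_le1]).  Averaging over the orders and applying Jensen's
    inequality to the exponential, #|F| <= exp(n c) as soon as the mean of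
    ln D_v(f) is at most c for all f and v ([card_le_expR]).

    The stability enters through the opposition of interests: if g and h are
    stable and v prefers its partner under g to w = h(v), then w prefers v to
    its partner under g ([opposition]).  Sort the stable partners of v by the
    preferences of v.  When the partner f(w) of some w in this list is
    revealed, f(v) is then known to lie on a definite side of w, so the
    possible values of f(v) lie between two consecutive revealed members of the
    list ([options_window]).  The member w is revealed when f(w) comes before
    v, and the vertices f(w) are distinct, so in a random order a given run of
    k consecutive members around f(v) is unrevealed with probability 1 / k.
    Inclusion-exclusion over the at most k such runs gives
    P(D_v >= k) <= k / k - (k - 1) / (k + 1) = 2 / (k + 1) ([run_tail]).

    Finally ln (k / (k - 1)) <= (1 / (k - 1) + 1 / k) / 2 (the trapezoid rule),
    and summing by parts the mean of ln D_v is at most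
    sum_(k >= 2) (1 / (k - 1) + 1 / k) / (k + 1), which telescopes to 5 / 4.
    Since exp (5 / 4) < 3.4904 < 3.55, the bound holds with C = 0. *)

Set Implicit Arguments.
Unset Strict Implicit.
Unset Printing Implicit Defensive.

Import Order.TTheory GRing.Theory Num.Theory.
Local Open Scope ring_scope.

(** * A majorant of the logarithm *)

Lemma expR_ge_quadratic (R : realType) (x : R) :
  0 <= x -> 1 + x + x ^+ 2 / 2 <= expR x.
Proof.
move=> x_ge0.
have -> : 1 + x + x ^+ 2 / 2 = series (exp_coeff x) 3.
  by rewrite /series /= !big_nat_recr //= big_nil /exp_coeff /= !divr1 add0r.
apply: nondecreasing_cvgn_le; last exact: is_cvg_series_exp_coeff.
apply/nondecreasing_seqP => n.
by rewrite /series /= big_nat_recr //= lerDl; exact: exp_coeff_ge0.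
Qed.

(** Inverting exp (- 1 / 40) >= 39 / 40 and raising it to the power 50 leaves just
    enough room: (40 / 39) ^ 50 is about 3.546. *)
Lemma expR_five_quarters (R : realType) : expR (5 / 4) <= 355 / 100 :> R.
Proof.
have -> : 5 / 4 = 50%:R * (1 / 40) :> R by lra.
rewrite expRM_natl.
have h : expR (1 / 40) <= 40 / 39 :> R.
  rewrite -[1 / 40]opprK expRN -[40 / 39]invrK lef_pV2 ?posrE ?expR_gt0 //; last lra.
  by apply: le_trans (expR_ge1Dx _); lra.
apply: le_trans (_ : (40 / 39) ^+ 50 <= _).
  by rewrite lerXn2r // nnegrE ?expR_ge0 //; lra.
lra.
Qed.

(** The trapezoid approximation of the integral of 1 / x from k - 1 to k. *)
Definition log_step (R : realFieldType) (k : nat) : R :=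
  (k.-1%:R^-1 + k%:R^-1) / 2.

Definition log_majorant (R : realFieldType) (N : nat) : R :=
  \sum_(2 <= k < N.+1) log_step R k.

Lemma log_step_ge0 (R : realFieldType) k : 0 <= log_step R k.
Proof. by rewrite divr_ge0 // addr_ge0 // invr_ge0. Qed.

(** The function 1 / x is convex, so the trapezoid sums exceed its integral
    ln N.  The quadratic lower bound of the exponential is precise enough: with
    c = (1 / m + 1 / (m + 1)) / 2, the difference between 1 + c + c ^ 2 / 2 and
    1 + 1 / m is exactly 1 / (8 m ^ 2 (m + 1) ^ 2). *)
Lemma le_expR_log_majorant (R : realType) (N : nat) :
  (0 < N)%N -> N%:R <= expR (log_majorant R N).
Proof.
case: N => // N _; elim: N => [|N IH].
  by rewrite /log_majorant big_geq // expR0.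
rewrite /log_majorant big_nat_recr //= expRD -/(log_majorant R N.+1).
set m : R := N.+1%:R in IH *.
have m_gt0 : 0 < m by rewrite ltr0n.
have step : 1 + m^-1 <= expR (log_step R N.+2).
  apply: le_trans (expR_ge_quadratic (log_step_ge0 _ _)).
  have -> : log_step R N.+2 = (m^-1 + (m + 1)^-1) / 2.
    by rewrite /log_step /= -[N.+2%:R]natr1.
  rewrite -subr_ge0.
  have -> : 1 + (m^-1 + (m + 1)^-1) / 2 + ((m^-1 + (m + 1)^-1) / 2) ^+ 2 / 2
            - (1 + m^-1) = (8 * m ^+ 2 * (m + 1) ^+ 2)^-1.
    by field; apply/andP; split; lra.
  by rewrite invr_ge0 -mulrA mulr_ge0 // mulr_ge0 // sqr_ge0.
have -> : N.+2%:R = m * (1 + m^-1).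
  by rewrite mulrDr mulr1 mulfV ?gt_eqF // natr1.
have minv_ge0 : 0 <= m^-1 by rewrite invr_ge0 ltW.
by apply: ler_pM => //; exact: addr_ge0.
Qed.

(** The terms are (1 / (k - 1) - 1 / (k + 1)) / 2 + (1 / k - 1 / (k + 1)), so the
    sum telescopes; the weights 2 / (k + 1) are the tail bounds of [run_tail]. *)
Lemma sum_log_step_le (R : realFieldType) (K : nat) :
  \sum_(2 <= k < K.+1) log_step R k * (2 / k.+1%:R) <= 5 / 4.
Proof.
suff : forall K, \sum_(2 <= k < K.+2) log_step R k * (2 / k.+1%:R)
    = 5 / 4 - K.+1%:R^-1 / 2 - 3 / 2 / K.+2%:R.
  case: K => [|K] H; first by rewrite big_geq //; lra.
  rewrite H.
  have h1 : 0 <= K.+1%:R^-1 :> R by rewrite invr_ge0.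
  have h2 : 0 <= K.+2%:R^-1 :> R by rewrite invr_ge0.
  by move: (K.+1%:R^-1) (K.+2%:R^-1) h1 h2 => a b; lra.
elim=> [|n IH]; first by rewrite big_geq //; lra.
rewrite big_nat_recr //= IH /log_step /= -!natr1.
set m : R := n%:R; have m_ge0 : 0 <= m by rewrite ler0n.
field; do ?[apply/andP; split]; lra.
Qed.

(** * Random orders *)

Definition first_in (T : finType) (s : {perm T}) (A : {set T}) (v : T) : bool :=
  [forall y in A, (enum_rank (s v) <= enum_rank (s y))%N].

(** Exactly one element of A comes first in a given order, and composing with
    a transposition shows that all elements of A are equally likely to do so. *)
Lemma card_first_in (T : finType) (A : {set T}) (v : T) : v \in A ->
  (#|[set s : {perm T} | first_in s A v]| * #|A|)%N = #|{perm T}|.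
Proof.
move=> vA.
have same x : x \in A ->
    #|[set s : {perm T} | first_in s A x]| = #|[set s | first_in s A v]|.
  move=> xA; rewrite -(card_imset _ (mulgI (tperm x v))); apply: eq_card => s.
  have tA y : y \in A -> tperm x v y \in A by case: tpermP => // ->.
  rewrite inE; apply/imsetP/forall_inP => [[t]|sv].
    rewrite inE => /forall_inP tx -> y yA.
    by rewrite !permM tpermR tx ?tA.
  exists (tperm x v * s)%g; last by rewrite mulgA tperm2 mul1g.
  rewrite inE; apply/forall_inP => y yA.
  by rewrite !permM tpermL sv ?tA.
have one (s : {perm T}) : (\sum_(x in A) first_in s A x = 1)%N.
  have [m mA mmin] := arg_minnP (fun y => enum_rank (s y) : nat) vA.
  rewrite (bigD1 m) //= big1 => [|y /andP[yA ym]].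
    by rewrite addn0 (_ : first_in _ _ _ = true) //; apply/forall_inP.
  apply/eqP; rewrite eqb0; apply: contra ym => /forall_inP /(_ _ mA) le_ym.
  apply/eqP.
  apply/(@perm_inj _ s)/enum_rank_inj/val_inj/eqP.
  by rewrite /= eqn_leq le_ym mmin.
transitivity (\sum_(x in A) \sum_(s : {perm T}) first_in s A x)%N.
  rewrite mulnC -sum_nat_const; apply: eq_bigr => x /same <-.
  by rewrite -sum1dep_card big_mkcond.
by rewrite exchange_big (eq_bigr (fun=> 1%N)) // sum1_card.
Qed.

Definition mean (R : realFieldType) (T : finType) (G : {perm T} -> R) : R :=
  (\sum_s G s) / #|{perm T}|%:R.

Lemma card_perm_gt0 (R : realFieldType) (T : finType) : 0 < #|{perm T}|%:R :> R.
Proof. by rewrite ltr0n; apply/card_gt0P; exists 1%g. Qed.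

Lemma mean_le (R : realFieldType) (T : finType) (G H : {perm T} -> R) :
  (forall s, G s <= H s) -> mean G <= mean H.
Proof.
by move=> le_GH; rewrite ler_pM2r ?invr_gt0 ?card_perm_gt0 // ler_sum.
Qed.

Lemma meanD (R : realFieldType) (T : finType) (G H : {perm T} -> R) :
  mean (fun s => G s + H s) = mean G + mean H.
Proof. by rewrite /mean big_split mulrDl. Qed.

Lemma meanZ (R : realFieldType) (T : finType) (c : R) (G : {perm T} -> R) :
  mean (fun s => c * G s) = c * mean G.
Proof. by rewrite /mean -mulr_sumr mulrA. Qed.

Lemma mean_const (R : realFieldType) (T : finType) (c : R) :
  mean (fun _ : {perm T} => c) = c.
Proof.
by rewrite /mean sumr_const -[c *+ _]mulr_natr mulfK // gt_eqF // card_perm_gt0.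
Qed.

Lemma mean_sum (R : realFieldType) (T : finType) (J : Type) (l : seq J)
    (P : pred J) (G : J -> {perm T} -> R) :
  mean (fun s => \sum_(i <- l | P i) G i s) = \sum_(i <- l | P i) mean (G i).
Proof. by rewrite /mean exchange_big mulr_suml. Qed.

Lemma mean_first_in (R : realFieldType) (T : finType) (A : {set T}) (v : T) :
  v \in A -> mean (fun s => (first_in s A v)%:R) = #|A|%:R^-1 :> R.
Proof.
move=> vA; have A_gt0 : (0 < #|A|)%N by apply/card_gt0P; exists v.
have n_gt0 := card_perm_gt0 R T.
rewrite /mean -natr_sum.
have -> : (\sum_s first_in s A v = #|[set s : {perm T} | first_in s A v]|)%N.
  by rewrite -sum1dep_card [RHS]big_mkcond.
have := n_gt0; rewrite -(card_first_in vA) natrM => cA_gt0.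
rewrite invfM mulrA mulfV ?mul1r //.
by apply: contraTneq cA_gt0 => ->; rewrite mul0r ltxx.
Qed.

(** The number of true cells minus the number of pairs of adjacent true cells is
    the number of maximal runs of true cells: it is positive when some cell is
    true.  This turns the probability of a union of overlapping windows into an
    alternating sum that can be evaluated. *)
Lemma adjacent_pairs_lt (g : nat -> bool) (n : nat) :
  (has g (iota 0 n.+1) + \sum_(i < n) (g i && g i.+1) <= \sum_(i < n.+1) g i)%N.
Proof.
elim: n => [|n IH]; first by rewrite big_ord0 big_ord1 /= orbF addn0.
have gn_has : g n ==> has g (iota 0 n.+1).
  by apply/implyP => gn; apply/hasP; exists n; rewrite // mem_iota add0n leq0n ltnSn.
rewrite -[n.+2]addn1 iotaD has_cat add0n addn1 big_ord_recr.
rewrite [X in (_ <= X)%N]big_ord_recr [has g (iota n.+1 1)]orbF.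
set h := has g (iota 0 n.+1) in gn_has IH *.
rewrite /=; move: gn_has IH; move: h (\sum_(i < n) _)%N (\sum_(i < n.+1) _)%N.
by case: (g n) (g n.+1) => [] [] [] //= p q _; lia.
Qed.

Definition window (T : finType) (x : nat -> T) (a k : nat) : {set T} :=
  [set y in map x (iota a k)].

Lemma mem_window (T : finType) (x : nat -> T) (a k i : nat) :
  (a <= i < a + k)%N -> x i \in window x a k.
Proof. by move=> aik; rewrite inE map_f // mem_iota. Qed.

Lemma card_window (T : finType) (x : nat -> T) (l a k : nat) :
  {in gtn l &, injective x} -> (a + k <= l)%N -> #|window x a k| = k.
Proof.
move=> x_inj le_akl; rewrite cardsE (card_uniqP _) ?size_map ?size_iota //.
rewrite map_inj_in_uniq ?iota_uniq // => i j; rewrite !mem_iota => hi hj.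
by apply: x_inj; rewrite inE; lia.
Qed.

(** A window of length k + 1 is the union of its two subwindows of length k. *)
Lemma first_in_windowS (T : finType) (s : {perm T}) (x : nat -> T) (v : T) a k :
  (0 < k)%N ->
  first_in s (window x a k.+1) v
    = first_in s (window x a k) v && first_in s (window x a.+1 k) v.
Proof.
move=> k_gt0; apply/forall_inP/andP => [H|[/forall_inP H1 /forall_inP H2] y].
  split; apply/forall_inP => y; rewrite inE => /mapP[i]; rewrite mem_iota => hi ->;
    apply/H/mem_window; lia.
rewrite inE => /mapP[i]; rewrite mem_iota => hi ->.
have [lt_i|ge_i] := ltnP i (a + k); first by apply/H1/mem_window; lia.
by apply/H2/mem_window; lia.
Qed.

(** The windows of length k that contain j start at consecutive positions; let w
    be their number, so that w <= k.  In each of them x j comes first with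
    probability 1 / k, and in two adjacent ones simultaneously with probability
    1 / (k + 1).  The event E is therefore of probability at most
    w / k - (w - 1) / (k + 1), which increases with w and is 2 / (k + 1) for
    w = k.  Windows cut off by the ends of the list only decrease w. *)
Lemma run_tail (R : realFieldType) (T : finType) (x : nat -> T) (l j k : nat)
    (E : {perm T} -> bool) :
  {in gtn l &, injective x} -> (0 < k)%N ->
  (forall s, E s -> exists a, [/\ (a <= j < a + k)%N, (a + k <= l)%N
                               & first_in s (window x a k) (x j)]) ->
  mean (fun s => (E s)%:R) <= 2 / k.+1%:R :> R.
Proof.
move=> x_inj k_gt0 HE.
(* The admissible windows are those that start between m and M. *)
set m := (j.+1 - k)%N; set M := minn j (l - k).
have [bad|good] := boolP ((M < m)%N || (l < k)%N).
  rewrite (_ : mean _ = 0) ?divr_ge0 //.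
  rewrite -[RHS](@mean_const R T); congr (_ / _); apply: eq_bigr => s _.
  by case: (boolP (E s)) => // /HE[a [h1 h2 _]]; lia.
set n := (M - m)%N.
pose g s i := first_in s (window x (m + i) k) (x j).
pose P s : R := \sum_(i < n.+1) (g s i)%:R
                + (-1) * \sum_(i < n) (first_in s (window x (m + i) k.+1) (x j))%:R.
have leP s : (E s)%:R <= P s.
  have := adjacent_pairs_lt (g s) n.
  rewrite -(ler_nat R) natrD !natr_sum /P.
  have -> : \sum_(i < n) (g s i && g s i.+1)%:R
      = \sum_(i < n) (first_in s (window x (m + i) k.+1) (x j))%:R :> R.
    by apply: eq_bigr => i _; rewrite first_in_windowS // /g addnS.
  have: (E s)%:R <= (has (g s) (iota 0 n.+1))%:R :> R.
    case: (boolP (E s)) => // /HE[a [h1 h2 h3]]; rewrite ler_nat lt0b.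
    apply/hasP; exists (a - m)%N; first by rewrite mem_iota; lia.
    by rewrite /g subnKC //; lia.
  by rewrite mulN1r; lra.
apply: le_trans (mean_le leP) _.
rewrite meanD meanZ !mean_sum.
rewrite (eq_bigr (fun=> k%:R^-1)) => [|i _]; last first.
  have := ltn_ord i => lt_in.
  rewrite mean_first_in ?(@card_window _ x l) //; [lia|apply: mem_window; lia].
rewrite [X in _ * X](eq_bigr (fun=> k.+1%:R^-1)) => [|i _]; last first.
  have := ltn_ord i => lt_in.
  rewrite mean_first_in ?(@card_window _ x l) //; [lia|apply: mem_window; lia].
rewrite !sumr_const !card_ord -![_^-1 *+ _]mulr_natr.
have : n.+1%:R <= k%:R :> R by rewrite ler_nat; lia.
have : 0 < k%:R :> R by rewrite ltr0n.
rewrite -[n.+1%:R]natr1 -[k.+1%:R]natr1; move: (k%:R) (n%:R) => K w K_gt0 le_wK.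
rewrite -subr_ge0.
have -> : 2 / (K + 1) - (K^-1 * (w + 1) + -1 * ((K + 1)^-1 * w))
   = (K - (w + 1)) / (K * (K + 1)) by field; lra.
by rewrite divr_ge0 ?mulr_ge0; lra.
Qed.

(** Summation by parts: log_majorant N is the sum of the steps k with k <= N, so
    its mean is the sum of the steps weighted by the tails of N. *)
Lemma mean_log_majorant (R : realFieldType) (T : finType) (N : {perm T} -> nat) K :
  (forall s, N s <= K)%N ->
  (forall k, (0 < k)%N -> mean (fun s => (k <= N s)%N%:R) <= 2 / k.+1%:R :> R) ->
  mean (fun s => log_majorant R (N s)) <= 5 / 4.
Proof.
move=> le_NK tail; apply: le_trans (sum_log_step_le R K).
rewrite (_ : mean _ = mean (fun s => \sum_(2 <= k < K.+1)
                                       log_step R k * (k <= N s)%N%:R)); last first.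
  congr (_ / _); apply: eq_bigr => s _.
  rewrite /log_majorant (big_nat_widen _ _ K.+1) ?ltnS // big_mkcond.
  by apply: eq_bigr => k _; rewrite ltnS; case: (_ <= _)%N; rewrite ?mulr1 ?mulr0.
rewrite mean_sum !big_nat; apply: ler_sum => k hk.
by rewrite meanZ ler_wpM2l ?log_step_ge0 // tail //; lia.
Qed.

(** * Revealing a function value by value *)

(** The values at v that remain possible once f is known on S. *)
Definition options (T T' : finType) (F : {set {ffun T -> T'}}) (S : {set T})
    (f : {ffun T -> T'}) (v : T) : {set T'} :=
  (fun g : {ffun T -> T'} => g v) @: [set g in F | [forall x in S, g x == f x]].

Lemma mem_options (T T' : finType) (F : {set {ffun T -> T'}}) (S : {set T})
    (f : {ffun T -> T'}) (v : T) : f \in F -> f v \in options F S f v.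
Proof. by move=> fF; apply: imset_f; rewrite inE fF; apply/forall_inP. Qed.

(** The product attached to f is the probability of obtaining f when the values
    along s are drawn one after the other, each uniformly among the possible
    ones.  The induction splits F according to the first value drawn. *)
Lemma sum_inv_options_le1 (R : realFieldType) (T T' : finType)
    (F : {set {ffun T -> T'}}) (s : seq T) :
  uniq s -> {in F &, forall f g : {ffun T -> T'}, {in s, f =1 g} -> f = g} ->
  \sum_(f in F) \prod_(v <- s)
    #|options F [set x | (index x s < index v s)%N] f v|%:R^-1 <= 1 :> R.
Proof.
elim: s F => [|v s IH] F /=.
  move=> _ F_inj; rewrite (eq_bigr (fun=> 1)) => [|f _]; last by rewrite big_nil.
  rewrite sumr_const lern1; apply/card_le1_eqP => f g fF gF.
  exact: F_inj.
move=> /andP[v_s s_uniq] F_inj.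
set O := [set f v | f : {ffun T -> T'} in F].
rewrite (partition_big (fun f : {ffun T -> T'} => f v) (mem O))
  => [|f fF] /=; last exact: imset_f.
apply: le_trans (_ : \sum_(a in O) #|O|%:R^-1 <= 1); last first.
  rewrite sumr_const -[_ *+ _]mulr_natr.
  have [->|O_neq0] := eqVneq #|O| 0%N; first by rewrite mulr0.
  by rewrite mulVf // pnatr_eq0.
apply: ler_sum => a _.
pose Fa := [set f in F | f v == a].
have FaF : Fa \subset F by apply/subsetP => f; rewrite inE => /andP[].
have {}IH := IH Fa s_uniq.
apply: le_trans (_ : #|O|%:R^-1 * 1 <= _); last by rewrite mulr1.
apply: le_trans (ler_wpM2l _ (IH _)); last 2 first.
- by rewrite invr_ge0.
- move=> f g; rewrite !inE => /andP[fF /eqP fa] /andP[gF /eqP ga] fg.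
  apply: F_inj => // x; rewrite inE => /predU1P[->|/fg //].
  by rewrite fa ga.
rewrite mulr_sumr; rewrite le_eqVlt; apply/orP; left.
apply/eqP; apply: eq_big => [f|f /andP[fF /eqP fa]].
  by rewrite inE.
rewrite big_cons; congr (_^-1 * _).
  rewrite /options (_ : [set g in F | _] = F) //.
  apply/setP => g; rewrite inE andb_idr //.
  by move=> _; apply/forall_inP => x; rewrite inE /= eqxx ltn0.
rewrite big_seq [RHS]big_seq; apply: eq_bigr => u u_s.
have uv : v != u by apply: contraNneq v_s => ->.
rewrite /options; set A := [set g in F | _]; set B := [set g in Fa | _].
suff -> : A = B by [].
apply/setP => g; rewrite !inE /= -andbA; congr (_ && _); rewrite (negPf uv).
apply/forall_inP/andP => [gf|[/eqP gv /forall_inP gf] x].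
  split; first by rewrite -fa; apply: gf; rewrite inE eqxx.
  apply/forall_inP => x; rewrite inE => xu; apply: gf; rewrite inE.
  by case: (v == x).
rewrite inE; have [<- _|_ xu] := eqVneq v x; first by rewrite gv fa.
by apply: gf; rewrite inE.
Qed.

Definition before (T : finType) (s : {perm T}) (v : T) : {set T} :=
  [set x | (enum_rank (s x) < enum_rank (s v))%N].

Lemma sum_inv_options_before_le1 (R : realFieldType) (T T' : finType)
    (F : {set {ffun T -> T'}}) (s : {perm T}) :
  \sum_(f in F) \prod_v #|options F (before s v) f v|%:R^-1 <= 1 :> R.
Proof.
pose l := [seq (s^-1)%g x | x <- enum T].
have mem_l x : x \in l by rewrite -[x](permK s) map_f // mem_enum.
have idx x : index x l = enum_rank (s x).
  rewrite -{1}[x](permK s) index_map; last exact: perm_inj.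
  by rewrite -{1}[s x]enum_rankK (enum_val_nth x) index_uniq ?enum_uniq // -cardE.
have l_uniq : uniq l by rewrite map_inj_uniq ?enum_uniq //; exact: perm_inj.
have F_inj : {in F &, forall f g : {ffun T -> T'}, {in l, f =1 g} -> f = g}.
  by move=> f g _ _ fg; apply/ffunP => x; apply: fg.
apply: le_trans (sum_inv_options_le1 R l_uniq F_inj); rewrite le_eqVlt.
apply/orP; left; apply/eqP; apply: eq_bigr => f _.
rewrite [RHS](perm_big (index_enum T)) /=; last first.
  apply: uniq_perm => //; first exact: index_enum_uniq.
  by move=> x; rewrite mem_l mem_index_enum.
apply: eq_bigr => v _; congr (#|pred_of_set (options F _ f v)|%:R^-1).
by apply/setP => x; rewrite !inE !idx.
Qed.

(** Jensen's inequality for the exponential, in the form of its tangent line at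
    the point - n c, which bounds the mean of each exp (- sum_v ln D_v) below by
    exp (- n c).  The majorant of ln D_v may replace ln D_v because it enters with
    a negative sign. *)
Lemma card_le_expR (R : realType) (T T' : finType) (F : {set {ffun T -> T'}})
    (c : R) :
  (forall f v, f \in F ->
     mean (fun s => log_majorant R #|options F (before s v) f v|) <= c) ->
  #|F|%:R <= expR c ^+ #|T|.
Proof.
move=> bound.
pose D s f v := #|options F (before s v) f v|.
pose H f s := \sum_v log_majorant R (D s f v).
set e := expR c ^+ #|T|.
have e_gt0 : 0 < e by rewrite exprn_gt0 // expR_gt0.
have eE : e = expR (#|T|%:R * c) by rewrite expRM_natl.
have weight f s : f \in F -> expR (- H f s) <= \prod_v (D s f v)%:R^-1.
  move=> fF; rewrite -sumrN expR_sum; apply: ler_prod => v _.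
  rewrite expR_ge0 expRN lef_pV2 ?posrE ?expR_gt0 ?ltr0n //=.
    apply: le_expR_log_majorant.
    by apply/card_gt0P; exists (f v); exact: mem_options.
  by apply/card_gt0P; exists (f v); exact: mem_options.
have tangent f s : e^-1 * (1 + #|T|%:R * c + (-1) * H f s) <= expR (- H f s).
  have -> : - H f s = - (#|T|%:R * c) + (#|T|%:R * c - H f s) by ring.
  rewrite expRD expRN -eE ler_wpM2l ?invr_ge0 ?(ltW e_gt0) //.
  by rewrite (le_trans _ (expR_ge1Dx _)) // addrA mulN1r.
have mean_weight f : f \in F -> e^-1 <= mean (fun s => \prod_v (D s f v)%:R^-1).
  move=> fF.
  apply: le_trans (mean_le (fun s => le_trans (tangent f s) (weight f s fF))).
  rewrite meanZ meanD meanZ mean_const ler_peMr ?invr_ge0 ?(ltW e_gt0) //.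
  have : mean (H f) <= #|T|%:R * c.
    rewrite mean_sum; apply: le_trans (_ : \sum_(v : T) c <= _).
      by apply: ler_sum => v _; exact: bound.
    by rewrite sumr_const -[c *+ _]mulr_natl.
  lra.
have : \sum_(f in F) e^-1 <= 1.
  apply: le_trans (_ : mean (fun s => \sum_(f in F) \prod_v (D s f v)%:R^-1) <= _).
    by rewrite mean_sum; apply: ler_sum => f; exact: mean_weight.
  apply: le_trans (mean_le (fun s => sum_inv_options_before_le1 R F s)) _.
  by rewrite mean_const.
by rewrite sumr_const -[_ *+ _]mulr_natl ler_pdivrMr // mul1r.
Qed.

(** * Stable matchings as partner functions *)

(** The value u is taken only if u has no partner. *)
Definition partner (V : finType) (M : {set {set V}}) (u : V) : V :=
  odflt u [pick v | (v != u) && ([set u; v] \in M)].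

Lemma edge_neq (V : finType) (M : {set {set V}}) (u v : V) :
  perfect_matching M -> [set u; v] \in M -> u != v.
Proof.
move=> /andP[_ /forall_inP H] /H; rewrite cards2.
by case: (u != v).
Qed.

Lemma edge_partner (V : finType) (M : {set {set V}}) (u : V) :
  perfect_matching M -> [set u; partner M u] \in M.
Proof.
move=> pM; have := pM => /andP[/andP[/eqP covM _] /forall_inP card2].
have /bigcupP[e eM ue] : u \in cover M by rewrite covM inE.
rewrite /partner; case: pickP => [v /andP[] //|none].
have /cards2P[x [y [xy eE]]] := card2 _ eM.
move: ue (eM); rewrite eE !inE => /orP[]/eqP uE.
  by move: (none y); rewrite uE -eE eM eq_sym xy.
by move: (none x); rewrite uE setUC -eE eM xy.
Qed.

Lemma partner_neq (V : finType) (M : {set {set V}}) (u : V) :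
  perfect_matching M -> partner M u != u.
Proof.
by move=> pM; rewrite eq_sym; apply: edge_neq pM (edge_partner u pM).
Qed.

Lemma partner_unique (V : finType) (M : {set {set V}}) (u v : V) :
  perfect_matching M -> [set u; v] \in M -> partner M u = v.
Proof.
move=> pM uvM; have := pM => /andP[/and3P[_ trivM _] _].
have eqE : [set u; partner M u] = [set u; v].
  rewrite -(def_pblock trivM (edge_partner u pM) (set21 _ _)).
  by rewrite (def_pblock trivM uvM (set21 _ _)).
have : partner M u \in [set u; v] by rewrite -eqE set22.
by rewrite !inE (negPf (partner_neq u pM)) => /eqP.
Qed.

Lemma partnerK (V : finType) (M : {set {set V}}) :
  perfect_matching M -> involutive (partner M).
Proof.
by move=> pM u; apply: partner_unique; rewrite // setUC edge_partner.
Qed.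

Lemma partner_inj (V : finType) (M N : {set {set V}}) :
  perfect_matching M -> perfect_matching N -> partner M =1 partner N -> M = N.
Proof.
suff sub (M1 N1 : {set {set V}}) : perfect_matching M1 -> perfect_matching N1 ->
    partner M1 =1 partner N1 -> M1 \subset N1.
  by move=> pM pN MN; apply/eqP; rewrite eqEsubset !sub.
move=> pM pN MN; apply/subsetP => e eM.
have := pM => /andP[_ /forall_inP card2].
have /cards2P[x [y [_ eE]]] := card2 _ eM.
by rewrite eE -(partner_unique pM (_ : [set x; y] \in M1)) ?MN ?edge_partner -?eE.
Qed.

(** The condition on u and v holds automatically for matched pairs: if f u = v,
    then u does not prefer v to itself. *)
Definition stable_fun (V : finType) (I : roommates_instance V) (f : V -> V) : Prop :=
  [/\ forall u, f u != u, involutive f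
    & forall u v, u != v -> ~~ (prefers I u v (f u) && prefers I v u (f v))].

Lemma stable_partner (V : finType) (I : roommates_instance V) (M : {set {set V}}) :
  stable_matching I M -> stable_fun I (partner M).
Proof.
move=> /andP[pM /forallP no_unstable].
split=> [u| |u v uv]; [exact: partner_neq|exact: partnerK|].
have [uvM|uvM] := eqVneq (partner M u) v.
  by rewrite uvM prefers_irr // inE eq_sym.
have /forallP/(_ v) := no_unstable u; apply: contra => bl.
rewrite /unstable_pair uv /=; apply/andP; split.
  by apply: contra uvM => /(partner_unique pM) ->.
apply/existsP; exists (partner M u); apply/existsP; exists (partner M v).
by rewrite !edge_partner.
Qed.

Definition better (V : finType) (I : roommates_instance V)
    (f g : V -> V) : {set V} :=
  [set u | prefers I u (f u) (g u)].

(** If u is better off under f, its partner under f must be better off under g: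
    otherwise the two of them would prefer each other to their partners under
    g. *)
Lemma partner_better (V : finType) (I : roommates_instance V)
    (f g : V -> V) :
  stable_fun I f -> stable_fun I g ->
  {in better I f g, forall u, f u \in better I g f}.
Proof.
move=> [f_neq fK _] [g_neq gK g_stable] u; rewrite !inE => ubetter.
have fg : f (f u) != g (f u).
  apply: contraTneq ubetter; rewrite fK => uE.
  have -> : g u = f u by rewrite {1}uE gK.
  by rewrite prefers_irr // inE f_neq.
have := prefers_total I (f_neq (f u)) (g_neq (f u)) fg.
case/orP => //; rewrite fK => pf.
have uf : u != f u by rewrite eq_sym.
by have := g_stable _ _ uf; rewrite ubetter pf.
Qed.

(** By [partner_better] f maps the vertices better off under f injectively into
    those better off under g, and g maps the latter injectively into the former.
    Both sets are thus equally large and g is a bijection between them. *)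
Lemma opposition (V : finType) (I : roommates_instance V)
    (f g : V -> V) (u : V) :
  stable_fun I f -> stable_fun I g ->
  prefers I u (f u) (g u) -> prefers I (g u) u (f (g u)).
Proof.
move=> sf sg ufg.
have [_ fK _] := sf; have [_ gK _] := sg.
have sub : g @: better I g f \subset better I f g.
  by apply/subsetP => _ /imsetP[w wB ->]; exact: partner_better wB.
have sub' : f @: better I f g \subset better I g f.
  by apply/subsetP => _ /imsetP[w wA ->]; exact: partner_better wA.
have eqA : g @: better I g f = better I f g.
  apply/eqP; rewrite eqEcard sub (card_imset _ (inv_inj gK)).
  by rewrite -(card_imset _ (inv_inj fK)) subset_leq_card.
have : u \in better I f g by rewrite inE.
by rewrite -eqA => /imsetP[w + uE]; rewrite inE uE gK.
Qed.

(** If f(v) and g(v) lie on different sides of w = h(v), then w prefers v to g(w)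
    by opposition, but not to f(w), as v and w do not block f.  Knowing the
    partner of w therefore separates f from g. *)
Lemma crossing (V : finType) (I : roommates_instance V)
    (f g h : V -> V) (v : V) :
  stable_fun I f -> stable_fun I g -> stable_fun I h ->
  prefers I v (g v) (h v) -> prefers I v (h v) (f v) -> g (h v) != f (h v).
Proof.
move=> [_ _ f_stable] sg sh gh hf; have [h_neq _ _] := sh.
have hg := opposition sg sh gh.
have vh : v != h v by rewrite eq_sym.
have := f_stable _ _ vh; rewrite hf /=.
by apply: contra => /eqP <-.
Qed.

(** The list enumerates the f(u) where u ranges over the stable partners of v in
    decreasing preference, and j is the position of f(v), so that its j-th
    entry is v itself.  A partner u of v counts as unseen when f(u) does not
    come before v.  All partners of v between the best and the worst remaining
    option are unseen: a seen one would separate f from one of these two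
    extremes by [crossing]. *)
Lemma options_window (V : finType) (I : roommates_instance V)
    (F : {set {ffun V -> V}}) (f : {ffun V -> V}) (v : V) :
  (forall g, g \in F -> stable_fun I g) -> f \in F ->
  exists (x : nat -> V) (l j : nat), {in gtn l &, injective x} /\
    forall (s : {perm V}) k, (0 < k <= #|options F (before s v) f v|)%N ->
    exists a, [/\ (a <= j < a + k)%N, (a + k <= l)%N
                & first_in s (window x a k) (x j)].
Proof.
move=> sF fF.
pose L := [set g v | g : {ffun V -> V} in F].
pose le_v := fun x y => (x == y) || prefers I v x y.
have L_neq u : u \in L -> u != v.
  by case/imsetP => g gF ->; have [] := sF _ gF.
pose l := sort le_v (enum L).
have mem_l u : (u \in l) = (u \in L) by rewrite mem_sort mem_enum.
have l_uniq : uniq l by rewrite sort_uniq enum_uniq.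
have le_total : {in L &, total le_v}.
  move=> a b /L_neq av /L_neq bv; rewrite /le_v [b == a]eq_sym.
  by have [//|ab] := eqVneq a b; exact: prefers_total.
have le_trans : {in l & &, transitive le_v}.
  move=> b a c; rewrite !mem_l => /L_neq bv /L_neq av /L_neq cv.
  move=> /predU1P[->//|ab] /predU1P[<-|bc]; first by rewrite /le_v ab orbT.
  by rewrite /le_v (prefers_trans bv av cv ab bc) orbT.
have l_sorted : sorted le_v l.
  by apply: (sort_sorted_in le_total); apply/allP => u; rewrite mem_enum.
have idx a b : a \in L -> b \in L -> (index a l < index b l)%N -> prefers I v a b.
  rewrite -!mem_l => al bl ab.
  have /predU1P[abE|//] := sorted_ltn_index_in le_trans l_sorted _ _ al bl ab.
  by rewrite abE ltnn in ab.
have [f_neq fK _] := sF _ fF.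
have fvL : f v \in L by apply: imset_f.
pose j := index (f v) l.
exists (fun i => f (nth v l i)), (size l), j; split.
  move=> a b; rewrite !inE => al bl /(inv_inj fK) /eqP.
  by rewrite nth_uniq // => /eqP.
have xj : f (nth v l j) = v by rewrite nth_index ?mem_l // fK.
move=> s k; set O := options _ _ _ _ => /andP[k_gt0 le_kO].
have fvO : f v \in O by exact: mem_options.
have [ulo loO lo_min] := arg_minnP (fun u => index u l) fvO.
have [uhi hiO hi_max] := arg_maxnP (fun u => index u l) fvO.
set lo := index ulo l in lo_min *; set hi := index uhi l in hi_max *.
have OL : {subset O <= L}.
  by move=> _ /imsetP[g + ->]; rewrite inE => /andP[gF _]; exact: imset_f.
have le_lo : (lo <= j)%N by exact: lo_min.
have le_hi : (j <= hi)%N by exact: hi_max.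
have lt_hi : (hi < size l)%N by rewrite index_mem mem_l OL.
have card_O : (#|O| <= hi.+1 - lo)%N.
  rewrite cardE -(size_map (fun u => index u l)) -(size_iota lo (hi.+1 - lo)).
  apply: uniq_leq_size.
    rewrite map_inj_in_uniq ?enum_uniq // => a b.
    rewrite !mem_enum => /OL aL /OL bL ab.
    by rewrite -(nth_index v (_ : a \in l)) ?mem_l // ab nth_index ?mem_l.
  move=> i /mapP[u]; rewrite mem_enum => uO ->.
  have := lo_min u uO; have := hi_max u uO; rewrite mem_iota /=; lia.
have unseen i : (lo <= i <= hi)%N ->
    (enum_rank (s v) <= enum_rank (s (f (nth v l i))))%N.
  move=> lo_i_hi; rewrite leqNgt; apply/negP => seen.
  set w := nth v l i in seen.
  have il : (i < size l)%N by lia.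
  have wL : w \in L by rewrite -mem_l mem_nth.
  have idx_w : index w l = i by rewrite index_uniq.
  have /imsetP[h hF wE] := wL.
  (* Members of F that agree with f on what was seen give w the partner that f
     gives it. *)
  have agree u : u \in O ->
      u != w /\ exists g : {ffun V -> V}, [/\ g \in F, u = g v & g w = f w].
    case/imsetP => g; rewrite inE => /andP[gF /forall_inP gf] uE.
    have [_ gK _] := sF _ gF.
    have /eqP : g (f w) == f (f w) by apply: gf; rewrite inE.
    rewrite fK => gfw.
    have gw : g w = f w by rewrite -[in LHS]gfw gK.
    split; last by exists g.
    apply: contraTneq seen => uw.
    by rewrite -gw -uw uE gK ltnn.
  have [lt_ij|gt_ij|eq_ij] := ltngtP i j.
  - have [ulow [g [gF uE gw]]] := agree _ loO.
    have lt_lo : (lo < i)%N.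
      rewrite ltn_neqAle; apply/andP; split; last by lia.
      apply: contra ulow => /eqP loE.
      by rewrite -(nth_index v (_ : ulo \in l)) ?mem_l ?OL // -/lo loE.
    have := crossing (sF _ fF) (sF _ gF) (sF _ hF) (v := v).
    rewrite -wE -uE gw eqxx => H; have : false; last by [].
by apply: H; apply: idx; rewrite ?idx_w // OL.
  - have [uhiw [g [gF uE gw]]] := agree _ hiO.
    have gt_hi : (i < hi)%N.
      rewrite ltn_neqAle; apply/andP; split; last by lia.
      apply: contra uhiw => /eqP hiE.
      by rewrite -(nth_index v (_ : uhi \in l)) ?mem_l ?OL // -/hi -hiE.
    have := crossing (sF _ gF) (sF _ fF) (sF _ hF) (v := v).
    rewrite -wE -uE gw eqxx => H; have : false; last by [].
    by apply: H; apply: idx; rewrite ?idx_w // OL.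
  - by move: seen; rewrite /w eq_ij xj ltnn.
(* The leftmost window of length k inside the gap that reaches j. *)
exists (maxn lo (j.+1 - k)); split; [lia|lia|].
rewrite xj; apply/forall_inP => y; rewrite inE => /mapP[i].
rewrite mem_iota => hi_i ->; apply: unseen; lia.
Qed.

Theorem corollary2 (R : realType) :
  exists C : R, forall (n : nat) (V : finType) (I : roommates_instance V),
    (1 <= n)%N -> #|V| = n ->
    #|[set M : {set {set V}} | stable_matching I M]|%:R
      <= (355%:R / 100%:R) ^+ n + C.
Proof.
exists 0 => n V I _ <-; rewrite addr0.
set stable := [set M | _].
pose F := [set finfun (partner M) | M in stable].
have card_F : #|F| = #|stable|.
  apply: card_in_imset => M N; rewrite !inE => /andP[pM _] /andP[pN _] /ffunP MN.
  by apply: partner_inj => // u; have := MN u; rewrite !ffunE.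
have sF g : g \in F -> stable_fun I g.
  case/imsetP => M; rewrite inE => sM ->.
  have [neq invo no_block] := stable_partner sM.
  by split=> [u|u|u v]; rewrite !ffunE //; apply: no_block.
rewrite -card_F; apply: le_trans (_ : expR (5 / 4) ^+ #|V| <= _); last first.
  by rewrite lerXn2r ?nnegrE ?expR_ge0 ?expR_five_quarters //; lra.
apply: card_le_expR => f v fF.
have [x [l [j [x_inj win]]]] := options_window v sF fF.
apply: (mean_log_majorant (K := #|V|)) => [s|k k_gt0]; first exact: max_card.
by apply: (run_tail R x_inj k_gt0) => s kD; apply: win; rewrite k_gt0.
Qed.
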